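(* The set $\bigcup_{2\leq n<\omega}\mathrm{L}(n)$ of all non-convergent bounded real sequences with finitely many accumulation points is densely lineable in $\ell_\infty$; that is, $\bigcup_{2\leq n<\omega}\mathrm{L}(n)\cup\{0\}$ contains a linear subspace of $\ell_\infty$ that is dense in $\ell_\infty$ (in the supremum norm).
   Context: $\ell_\infty$ is the real Banach space of bounded real sequences $x=(x(n))_{n\in\omega}$ with the supremum norm, where $\omega=\{0,1,2,\dots\}$. For $x\in\ell_\infty$, a real $\eta$ is an accumulation point of $x$ if $\{n\in\omega: |x(n)-\eta|<\varepsilon\}$ is infinite for all $\varepsilon>0$; $\mathrm{L}_x$ denotes the set of accumulation points of $x$. For a cardinal $\kappa$, $\mathrm{L}(\kappa)=\{x\in\ell_\infty: |\mathrm{L}_x|=\kappa\}$. A subset $M$ of a topological vector space $X$ is densely lineable in $X$ if $M\cup\{0\}$ contains a linear subspace that is dense in $X$. *)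

(* Defs.v *)
From HB Require Import structures.
From mathcomp Require Import all_boot all_order all_algebra.
From mathcomp Require Import all_classical all_reals all_analysis.

Set Implicit Arguments.
Unset Strict Implicit.
Unset Printing Implicit Defensive.

Import Order.TTheory GRing.Theory Num.Theory.
Import numFieldNormedType.Exports.

Local Open Scope classical_set_scope.
Local Open Scope card_scope.
Local Open Scope ring_scope.

Definition bounded_seq (R : realType) : {pred nat -> R} :=
  mem (bounded_fun : set (nat -> R)).

Record linfty (R : realType) := Linfty {
  linfty_seq :> nat -> R;
  _ : linfty_seq \in @bounded_seq R }.

Lemma bounded_seqP (R : realType) (x : nat -> R) :
  x \in @bounded_seq R <-> exists M, forall n, `|x n| <= M.
Proof.
split=> [|[M xM]].
  rewrite inE /= => -[M [_ xM]]; exists (M + 1) => n.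
  by apply: (xM _ _ n) => //; rewrite ltrDl.
rewrite inE /=; exists M; split; first exact: num_real.
by move=> N MN n _; exact: le_trans (xM n) (ltW MN).
Qed.

Lemma bounded_seq_submod_closed (R : realType) : submod_closed (@bounded_seq R).
Proof.
split; first by apply/bounded_seqP; exists 0 => n; rewrite normr0.
move=> a x y /bounded_seqP[M xM] /bounded_seqP[N yN].
apply/bounded_seqP; exists (`|a| * M + N) => n.
apply: (le_trans (ler_normD _ _)); apply: lerD; last exact: yN.
by rewrite normrM ler_wpM2l.
Qed.

HB.instance Definition _ (R : realType) :=
  GRing.isSubmodClosed.Build R (nat -> R) (@bounded_seq R)
    (@bounded_seq_submod_closed R).

HB.instance Definition _ (R : realType) := [isSub for @linfty_seq R].
HB.instance Definition _ (R : realType) := [Choice of linfty R by <:].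
HB.instance Definition _ (R : realType) :=
  [SubChoice_isSubLmodule of linfty R by <:].

Definition linfty_norm (R : realType) (x : linfty R) : R :=
  sup (range (fun n => `|x n|)).

Lemma ler_linfty_norm (R : realType) (x : linfty R) (n : nat) :
  `|x n| <= linfty_norm x.
Proof.
apply: ub_le_sup; last by exists n.
have /bounded_seqP[M xM] := valP x.
by exists M => _ [k _ <-]; exact: xM.
Qed.

Lemma linfty_norm_ler (R : realType) (x : linfty R) (M : R) :
  (forall n, `|x n| <= M) -> linfty_norm x <= M.
Proof.
move=> xM; apply: ge_sup; first by exists `|x 0%N|, 0%N.
by move=> _ [n _ <-]; exact: xM.
Qed.

Lemma linfty_normD (R : realType) (x y : linfty R) :
  linfty_norm (x + y) <= linfty_norm x + linfty_norm y.
Proof.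
apply: linfty_norm_ler => n; apply: (le_trans (ler_normD _ _)).
by apply: lerD; exact: ler_linfty_norm.
Qed.

Lemma linfty_normZ (R : realType) (a : R) (x : linfty R) :
  linfty_norm (a *: x) = `|a| * linfty_norm x.
Proof.
have le_normZ b (y : linfty R) : linfty_norm (b *: y) <= `|b| * linfty_norm y.
  apply: linfty_norm_ler => n.
  by rewrite normrM ler_wpM2l // ler_linfty_norm.
apply/eqP; rewrite eq_le le_normZ /=.
have [->|a0] := eqVneq a 0.
  by rewrite normr0 mul0r (le_trans (normr_ge0 _) (ler_linfty_norm _ 0%N)).
have := le_normZ a^-1 (a *: x).
by rewrite scalerA mulVf // scale1r normfV ler_pdivlMl // normr_gt0.
Qed.

Lemma linfty_norm_eq0 (R : realType) (x : linfty R) :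
  linfty_norm x = 0 -> x = 0.
Proof.
move=> x0; apply/val_inj/funext => n; apply/eqP.
by rewrite -normr_le0 -x0 ler_linfty_norm.
Qed.

HB.instance Definition _ (R : realType) :=
  @Lmodule_isNormed.Build R (linfty R) (@linfty_norm R)
    (@linfty_normD R) (@linfty_normZ R) (@linfty_norm_eq0 R).

Lemma linfty_normE (R : realType) (x : linfty R) :
  `|x| = sup (range (fun n => `|x n|)).
Proof. by []. Qed.

Definition accumulation_points (R : realType) (x : nat -> R) : set R :=
  [set eta | forall eps : R, 0 < eps ->
    infinite_set [set n : nat | `|x n - eta| < eps]].

(* Only finite cardinals are needed: L(n) for n : nat, with `I_n the standard
   set of cardinality n. *)
Definition Lset (R : realType) (n : nat) : set (linfty R) :=
  [set x | accumulation_points x #= `I_n].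

Definition densely_lineable (K : numFieldType) (X : topologicalLmodType K)
    (M : set X) :=
  exists V : set X,
    [/\ submod_closed (mem V), dense V & V `<=` M `|` [set 0]].

(* Main.v *)
Require Import Defs.
From mathcomp Require Import all_boot all_order all_algebra.
From mathcomp Require Import all_classical all_reals all_analysis.
From mathcomp Require Import lra.
Import Order.TTheory GRing.Theory Num.Theory.
Import numFieldNormedType.Exports.

Local Open Scope classical_set_scope.
Local Open Scope ring_scope.

(** A bounded sequence with finite range has finitely many accumulation points,
    and at least two unless it is eventually constant.  Finite-range sequences
    are dense, so it suffices to find a dense space [V] of them that meets the
    space [C] of eventually constant ones only in 0.  The sequence 1 and the
    Dirac sequences span [C]; add to each of them, infinitely often, ever
    smaller multiples of indicators of disjoint infinite sets.  The span [V0] of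
    the results meets [C] trivially and has [C] in its closure.  By Zorn's lemma
    [V0] extends to a complement [V] of [C]; the closure of [V] contains [V] and
    [C], hence every finite-range sequence. *)

(** * Complements of linear subspaces *)

Definition submodule {K : pzRingType} {X : lmodType K} (V : set X) :=
  V 0 /\ forall a x y, V x -> V y -> V (a *: x + y).

Lemma submoduleP {K : pzRingType} {X : lmodType K} (V : set X) :
  submod_closed (mem V) <-> submodule V.
Proof.
split=> -[V0 VD]; split; rewrite ?inE // in V0 *.
- by move=> a x y Vx Vy; have := VD a x y; rewrite !inE; apply.
- by move=> a x y; rewrite !inE; exact: VD.
Qed.

Lemma submoduleZ {K : pzRingType} {X : lmodType K} (V : set X) a x :
  submodule V -> V x -> V (a *: x).
Proof. by move=> [V0 VD] Vx; rewrite -[_ *: _]addr0; exact: VD. Qed.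

Lemma submoduleD {K : pzRingType} {X : lmodType K} (V : set X) x y :
  submodule V -> V x -> V y -> V (x + y).
Proof. by move=> [V0 VD] Vx; rewrite -[x in x + _]scale1r; exact: VD. Qed.

(** Take [V] maximal by Zorn. Were some [u] in [U] outside [V + C], adjoining [u] to [V] would keep
    the intersection with [C] trivial. *)
Lemma complement_extension {K : fieldType} {X : lmodType K} (U C V0 : set X) :
  submodule U -> submodule C -> submodule V0 -> V0 `<=` U ->
  V0 `&` C `<=` [set 0] ->
  exists V, [/\ submodule V, V0 `<=` V, V `<=` U, V `&` C `<=` [set 0] &
    forall u, U u -> exists2 v, V v & C (u - v)].
Proof.
move=> lU lC lV0 V0U V0C.
pose good V := [/\ submodule V, V `<=` U & V `&` C `<=` [set 0]].
(* Maximality is over those [A] whose union with [V0] is good: the empty chain then yields [V0]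
   itself. *)
have [|A [gA maxA]] := @Zorn_bigcup X [set A | good (A `|` V0)].
  move=> F gF Ftot; split.
  - split; first by right; case: lV0.
    move=> a x y [[A FA Ax]|V0x] [[B FB By]|V0y].
    + have [AB|BA] := Ftot _ _ FA FB.
        have [lB _ _] := gF _ FB.
        have [||?|] := lB.2 a x y; [by left; exact: AB|by left| |by right].
        by left; exists B.
      have [lA _ _] := gF _ FA.
      have [||?|] := lA.2 a x y; [by left|by left; exact: BA| |by right].
      by left; exists A.
    + have [lA _ _] := gF _ FA.
      have [||?|] := lA.2 a x y; [by left|by right| |by right].
      by left; exists A.
    + have [lB _ _] := gF _ FB.
      have [||?|] := lB.2 a x y; [by right|by left| |by right].
      by left; exists B.
    + by right; exact: lV0.2.
  - move=> x [[A FA Ax]|]; last exact: V0U.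
    by have [_ + _] := gF _ FA; apply; left.
  - move=> x [[[A FA Ax]|V0x] Cx]; last exact: V0C.
    by have [_ _] := gF _ FA; apply; split => //; left.
have [lV VU VC] := gA.
exists (A `|` V0); split => // u Uu.
apply: contrapT => nu.
pose B := [set x | exists a v, (A `|` V0) v /\ x = a *: u + v].
have AB : A `|` V0 `<=` B.
  by move=> x Vx; exists 0, x; rewrite scale0r add0r.
have Vu : ~ (A `|` V0) u.
  by move=> Vu; apply: nu; exists u => //; rewrite subrr; case: lC.
apply: (maxA B).
  split; first by move=> x Ax; apply: AB; left.
  move=> BA; apply: Vu; left; apply: BA; exists 1, 0.
  by rewrite scale1r addr0; split => //; case: lV.
rewrite /= (_ : B `|` V0 = B); last first.
  by apply/seteqP; split => x; [case=> // V0x; apply: AB; right|left].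
split.
- split; first by apply: AB; case: lV.
  move=> a _ _ [b [v [Vv ->]]] [c [w [Vw ->]]].
  exists (a * b + c), (a *: v + w); split; first exact: lV.2.
  by rewrite scalerDr scalerDl scalerA addrACA.
- by move=> _ [b [v [Vv ->]]]; apply: lU.2 => //; exact: VU.
- move=> _ [[a [v [Vv ->]]] Cx].
  have [a0|a0] := eqVneq a 0.
    move: Cx; rewrite a0 scale0r add0r => Cv; exact: VC.
  (* Dividing [a *: u + v], an element of [C], by [a] puts [u] in [V + C], against [nu]. *)
  exfalso; apply: nu; exists (- a^-1 *: v); first exact: submoduleZ.
  rewrite scaleNr opprK.
  have := submoduleZ _ a^-1 _ lC Cx.
  by rewrite scalerDr scalerA mulVf // scale1r.
Qed.

(** * Finite-range and eventually constant sequences *)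

Section Sequences.
Variable R : realType.
Implicit Types x y : nat -> R.

Definition eventually_constant x := exists c N, forall n, (N <= n)%N -> x n = c.

Lemma finite_range_linear a x y : finite_set (range x) ->
  finite_set (range y) -> finite_set (range (a *: x + y)).
Proof.
move=> fx fy; have := finite_image2 (fun s t => a * s + t) fx fy.
apply: sub_finite_set => _ [n _ <-]; exists (x n); first by exists n.
by exists (y n) => //; exists n.
Qed.

Lemma eventually_constant_linear a x y : eventually_constant x ->
  eventually_constant y -> eventually_constant (a *: x + y).
Proof.
move=> [c [N xc]] [d [M yd]]; exists (a * c + d), (maxn N M) => n.
by rewrite geq_max => /andP[/xc <- /yd <-].
Qed.

(** Otherwise [B] would be a finite union of finite sets. The witness in [B] later tells two such
    values apart. *)
Lemma finite_range_pigeonhole x (B : set nat) : finite_set (range x) ->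
  infinite_set B -> exists2 v, infinite_set [set n | B n /\ x n = v] &
    exists2 n, B n & x n = v.
Proof.
move=> fx iB; apply: contrapT => nv; apply: iB.
have : finite_set (\bigcup_(v in range x) [set n | B n /\ x n = v]).
  apply: bigcup_finite => // _ [n _ <-].
  have [Bn|Bn] := pselect (exists2 m, B m & x m = x n).
    by apply: contrapT => inf; apply: nv; exists (x n).
  apply: (sub_finite_set _ (finite_set0 nat)) => m [Bm xmn].
  by apply: Bn; exists m.
by apply: sub_finite_set => n Bn; exists (x n) => //; exists n.
Qed.

Lemma finite_set_ub {d} {T : orderType d} (A : set T) (b : T) : finite_set A ->
  exists M, forall a, A a -> (a <= M)%O.
Proof.
move=> /finite_seqP[s ->]; exists (\big[Order.max/b]_(v <- s) v) => v vs.
exact: (le_bigmax_seq b v predT id).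
Qed.

(** The values other than [eta] form a finite, hence closed, set, so a small ball around [eta]
    contains none of them. *)
Lemma accumulation_points_finite_range x : finite_set (range x) ->
  accumulation_points x = [set v | infinite_set [set n | x n = v]].
Proof.
move=> fx; apply/seteqP; split => [eta acc|v inf eps e0].
  pose D := range x `\ eta.
  have oD : open (~` D).
    apply/closed_openC/(compact_closed (@Rhausdorff R))/finite_compact.
    exact: finite_setD.
  have Deta : (~` D) eta by move=> -[_]; exact.
  have /nbhs_ballP[e /= e0 eD] := open_nbhs_nbhs (conj oD Deta).
  apply: contra_not (acc e e0); apply: sub_finite_set => n /= xn.
  apply: contrapT => neq; apply: (eD (x n)); last by split => //; exists n.
  by rewrite -ball_normE /= distrC.
apply: contra_not inf; apply: sub_finite_set => n /= ->.
by rewrite subrr normr0.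
Qed.

(** Some value [v] occurs infinitely often, and so do terms different from [v], among which the
    pigeonhole principle finds a second value [w]. *)
Lemma Lset_finite_range (x : linfty R) : finite_set (range x) ->
  ~ eventually_constant x -> exists2 k, (2 <= k)%N & Lset k x.
Proof.
move=> fx nec.
have LE := accumulation_points_finite_range _ fx.
have [v iv _] := finite_range_pigeonhole x setT fx infinite_nat.
have inec : infinite_set [set n | x n <> v].
  move=> fin; apply: nec.
  have [N xN] := finite_set_ub _ 0%N fin.
  exists v, N.+1 => n Nn; apply: contrapT => /xN.
  by rewrite leEnat leqNgt Nn.
have [w iw [m xmv xmw]] := finite_range_pigeonhole x _ fx inec.
have : finite_set (accumulation_points x).
  apply: sub_finite_set fx => u; rewrite LE /= => iu.
  apply: contrapT => nu; apply: iu.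
  apply: (sub_finite_set _ (finite_set0 nat)) => n /= xn.
  by apply: nu; exists n.
have vL : accumulation_points x v.
  by rewrite LE /=; apply: contra_not iv; apply: sub_finite_set => n [].
have wL : accumulation_points x w.
  by rewrite LE /=; apply: contra_not iw; apply: sub_finite_set => n [].
move=> /finite_setP[[|[|k]] Lk]; last by exists k.+2.
  by move: Lk; rewrite II0 card_eq0 => /eqP L0; rewrite L0 in vL.
have /eq_cardSP[u Lu] := Lk.
rewrite II0 card_eq0 => /eqP /seteqP[L0 _].
have Eu z : accumulation_points x z -> z = u.
  by move=> Lz; apply: contrapT => zu; apply: (L0 z).
by exfalso; apply: xmv; rewrite xmw (Eu _ vL) (Eu _ wL).
Qed.

Lemma finite_range_linfty x : finite_set (range x) ->
  exists z : linfty R, z = x :> (nat -> R).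
Proof.
move=> fx; have [M xM] := finite_set_ub _ 0 (finite_image Num.norm fx).
have xb : x \in @bounded_seq R.
  by apply/bounded_seqP; exists M => n; apply: xM; exists (x n) => //; exists n.
by exists (Linfty xb).
Qed.

Lemma finite_range_approx (y : linfty R) (e : R) : 0 < e ->
  exists2 s : linfty R, finite_set (range s) & forall n, `|y n - s n| <= e.
Proof.
move=> e0; have /bounded_seqP[M yM'] := valP y.
have {yM'}yM n : `|y n| <= M := yM' n.
(* Round [y n + M], nonnegative as truncation requires, down to a multiple of [e]; finitely many
   multiples occur because [y n + M <= M + M]. *)
pose t (k : nat) := e * k%:R - M.
pose s n := t (Num.trunc ((y n + M) / e)).
have fs : finite_set (range s).
  have := finite_image t (finite_II (Num.trunc ((M + M) / e)).+1).
  apply: sub_finite_set => _ [n _ <-].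
  exists (Num.trunc ((y n + M) / e)) => //=.
  rewrite ltnS; apply: le_truncn; rewrite ler_pM2r ?invr_gt0 // lerD2r.
  exact: le_trans (ler_norm _) (yM n).
have [z zs] := finite_range_linfty _ fs.
exists z; rewrite zs // => n; rewrite /s /t.
have : 0 <= (y n + M) / e.
  apply: divr_ge0; last exact: ltW.
  by have := yM n; rewrite ler_norml => /andP[+ _]; lra.
move=> /truncn_itv; rewrite ler_pdivlMr // ltr_pdivrMr //.
rewrite -natr1 => /andP[]; set k := _%:R => lo hi.
by rewrite ler_norml; apply/andP; split; nra.
Qed.

(** * A linear space meeting the eventually constant sequences only in 0 *)

(* The constant 1 for [i = 0], the Dirac sequence at [i.-1] otherwise. *)
Definition unit_seq (i : nat) : nat -> R :=
  fun m => ((i == 0%N) || (i == m.+1))%:R.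

(* Plays two roles: the fibre [ruler = j] carries the perturbation of index [j],
   and [ruler j] selects which spanning sequence of [C] the index [j] perturbs. *)
Definition ruler (m : nat) := logn 2 m.+1.

Lemma ruler_infinitely_often j N : exists2 m, (N <= m)%N & ruler m = j.
Proof.
(* The odd factor [N.*2.+1] leaves the 2-adic valuation at [j] and makes the index at least [N]. *)
exists (2 ^ j * N.*2.+1).-1.
  rewrite -ltnS prednK ?muln_gt0 ?expn_gt0 //.
  apply: (@leq_trans N.*2.+1); first by rewrite ltnS -addnn leq_addr.
  by rewrite leq_pmull // expn_gt0.
rewrite /ruler prednK ?muln_gt0 ?expn_gt0 // lognM ?expn_gt0 // pfactorK //.
by rewrite logn_coprime ?addn0 // coprime2n /= odd_double.
Qed.

Lemma ruler_leq m : (ruler m <= m)%N.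
Proof. by rewrite -ltnS ltn_logl. Qed.

Definition perturbed j : nat -> R :=
  j.+1%:R^-1 *: (fun m => (ruler m == j)%:R) + unit_seq (ruler j).

Lemma finite_range_indicator (P : nat -> bool) :
  finite_set (range (fun m => (P m)%:R : R)).
Proof.
apply: (sub_finite_set _ (finite_set2 1 0)) => _ [m _ <-] /=.
by case: (P m); [left|right].
Qed.

Lemma perturbed_finite_range j : finite_set (range (perturbed j)).
Proof. by apply: finite_range_linear; apply: finite_range_indicator. Qed.

(** Polynomials serve as finitely supported coefficient families, so the range of [comb] is the span
    of the [perturbed j]. *)
Definition comb (p : {poly R}) : nat -> R :=
  \sum_(j < size p) p`_j *: perturbed j.

Lemma comb_widen (p : {poly R}) N : (size p <= N)%N ->
  comb p = \sum_(j < N) p`_j *: perturbed j.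
Proof.
move=> pN; rewrite /comb (big_ord_widen _ (fun j => p`_j *: perturbed j) pN).
rewrite big_mkcond; apply: eq_bigr => j _; case: ltnP => // pj.
by rewrite nth_default // scale0r.
Qed.

Lemma comb_linear a p q : comb (a *: p + q) = a *: comb p + comb q.
Proof.
pose N := maxn (size (a *: p + q)) (maxn (size p) (size q)).
rewrite !(@comb_widen _ N) /N ?leq_max ?leqnn ?orbT //.
rewrite scaler_sumr -big_split; apply: eq_bigr => j _ /=.
by rewrite coefD coefZ scalerDl scalerA.
Qed.

Lemma comb_finite_range p : finite_set (range (comb p)).
Proof.
rewrite /comb; elim/big_rec: _ => [|j x _ fx].
  exact: (finite_range_indicator (fun=> false)).
by apply: finite_range_linear => //; exact: perturbed_finite_range.
Qed.

Lemma combXn j : comb 'X^j = perturbed j.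
Proof.
rewrite (@comb_widen _ j.+1) ?size_polyXn // big_ord_recr /= coefXn eqxx.
rewrite scale1r big1 ?add0r // => i _.
by rewrite coefXn ltn_eqF // scale0r.
Qed.

Lemma comb_eventually_constant p : eventually_constant (comb p) -> p = 0.
Proof.
move=> [c [M pc]]; pose N := size p.
(* Limits along the fibres [ruler = j] are [C + p`_j / j.+1], and [p`_N = 0]. *)
pose C := \sum_(i < N.+1) p`_i * (ruler i == 0%N)%:R.
have coefE j : (j <= N)%N -> c = C + p`_j / j.+1%:R.
  (* Past [M] the value is [c]; past [N] every Dirac sequence in the sum vanishes, since
     [ruler i <= i <= N]. *)
  rewrite -ltnS => jN; have [m + mj] := ruler_infinitely_often j (maxn M N.+1).
  rewrite geq_max => /andP[Mm Nm].
  rewrite -(pc _ Mm) (@comb_widen _ N.+1) ?leqnSn // fct_sumE.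
  under eq_bigr => i _.
    rewrite /perturbed /unit_seq !fctE mj (_ : (ruler i == m.+1) = false).
      rewrite orbF scalerDr.
      over.
    apply/ltn_eqF; apply: leq_ltn_trans (ruler_leq i) _.
    by rewrite ltnS; exact: leq_trans (ltnW (ltn_ord i)) Nm.
  rewrite big_split addrC; congr (_ + _).
  rewrite (bigD1 (Ordinal jN)) //= eqxx big1 => [|i ij].
    by rewrite addr0 /GRing.scale /= mulr1.
  by rewrite (negbTE (_ : j != i)) ?scaler0 // eq_sym.
have cC : c = C by rewrite (coefE N) // nth_default // mul0r addr0.
apply/polyP => j; rewrite coef0; have [jN|] := ltnP j N; last first.
  exact: nth_default.
have /eqP := coefE j (ltnW jN).
rewrite cC -[X in X == _]addr0 (inj_eq (addrI _)) eq_sym mulf_eq0 invr_eq0.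
by rewrite pnatr_eq0 orbF => /eqP.
Qed.

(** * Sup-norm approximation of eventually constant sequences *)

Definition approximable (V : set (linfty R)) x :=
  forall e : R, 0 < e -> exists2 v, V v & forall m, `|x m - v m| <= e.

Lemma approximable_linear V a x y : submodule V -> approximable V x ->
  approximable V y -> approximable V (a *: x + y).
Proof.
move=> lV Vx Vy e e0.
(* Adding 1 keeps the divisor nonzero when [a = 0]. *)
have d0 : 0 < `|a| + 1 by rewrite ltr_wpDl.
have [v Vv xv] := Vx (e / (`|a| + 1) / 2) ltac:(by rewrite !divr_gt0).
have [w Vw yw] := Vy (e / 2) ltac:(by rewrite divr_gt0).
exists (a *: v + w); first exact: lV.2.
move=> m; rewrite !fctE.
have -> : a *: x m + y m - (a *: v + w) m = a * (x m - v m) + (y m - w m).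
  by rewrite mulrBr opprD addrACA.
apply: (le_trans (ler_normD _ _)); rewrite normrM [leRHS](splitr e).
apply: lerD => //; apply: (le_trans (ler_wpM2l (normr_ge0 a) (xv m))).
rewrite mulrA ler_pM2r // mulrA ler_pdivrMr // mulrC ler_pM2l //.
by rewrite lerDl.
Qed.

Lemma approximable_unit_seq V i :
  (forall x : linfty R, (exists p, x = comb p :> (nat -> R)) -> V x) ->
  approximable V (unit_seq i).
Proof.
move=> V0 e e0.
(* This makes [j.+1] exceed [e^-1], so the perturbation, of size at most [j.+1%:R^-1], stays below
   [e]. *)
have [j jN ji] := ruler_infinitely_often i (Num.trunc e^-1).
have [z zj] := finite_range_linfty _ (perturbed_finite_range j).
exists z; first by apply: V0; exists 'X^j; rewrite combXn.
move=> m; rewrite zj /perturbed ji !fctE opprD addrCA subrr addr0 normrN.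
rewrite normrM normfV normr_nat.
apply: (@le_trans _ _ j.+1%:R^-1).
  by rewrite ler_piMr // normr_nat; case: (_ == _).
rewrite invf_ple ?posrE ?ltr0n //.
apply: ltW; apply: lt_le_trans (truncnS_gt _) _.
by rewrite ler_nat.
Qed.

Lemma approximable_eventually_constant V x : submodule V ->
  (forall z : linfty R, (exists p, z = comb p :> (nat -> R)) -> V z) ->
  eventually_constant x -> approximable V x.
Proof.
move=> lV V0 [c [N xc]].
(* Subtracting the limit [c] leaves a finite combination of Dirac sequences. *)
have -> : x = c *: unit_seq 0 + \sum_(i < N) (x i - c) *: unit_seq i.+1.
  apply/funext => m; rewrite !fctE fct_sumE /unit_seq /= [c *: _]mulr1.
  have [mN|Nm] := ltnP m N; last first.
    rewrite xc // big1 ?addr0 // => i _; rewrite fctE eqSS ltn_eqF ?scaler0 //.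
    exact: leq_trans Nm.
  rewrite (bigD1 (Ordinal mN)) //= fctE eqxx big1 => [|i im].
    by rewrite addr0 [_ *: _]mulr1 addrC subrK.
  by rewrite fctE eqSS (negbTE (_ : i != m :> nat)) ?scaler0.
apply: approximable_linear => //; first exact: approximable_unit_seq.
elim/big_rec: _ => [e e0|i y _ ay]; last first.
  by apply: approximable_linear => //; exact: approximable_unit_seq.
by exists 0 => [|m]; [case: lV|rewrite subrr normr0 ltW].
Qed.

End Sequences.

Theorem theorem3p6 (R : realType) :
  densely_lineable (\bigcup_(n in [set n | (2 <= n)%N]) @Lset R n).
Proof.
pose U := [set x : linfty R | finite_set (range x)].
pose C := [set x : linfty R | eventually_constant _ x].
pose V0 := [set x : linfty R | exists p, x = comb _ p :> (nat -> R)].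
have lU : submodule U.
  split; first exact: (finite_range_indicator R (fun=> false)).
  by move=> a x y; exact: finite_range_linear.
have lC : submodule C.
  split; first by exists 0, 0%N.
  by move=> a x y; exact: eventually_constant_linear.
have lV0 : submodule V0.
  split; first by exists 0; rewrite /comb size_poly0 big_ord0.
  move=> a x y [p xp] [q yq]; exists (a *: p + q).
  by rewrite comb_linear -xp -yq.
have [||V [lV V0V VU VC UVC]] := complement_extension U C V0 lU lC lV0.
- by move=> x [p xp]; rewrite /U /= xp; exact: comb_finite_range.
- move=> x [[p xp]]; rewrite /C /= xp => /comb_eventually_constant p0.
  by apply/val_inj; rewrite /= xp p0 /comb size_poly0 big_ord0.
exists V; split; first exact/submoduleP.
- move=> O [y Oy] oO.
  have /nbhs_ballP[e /= e0 eO] := open_nbhs_nbhs (conj oO Oy).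
  (* The norm bound below is non-strict and the ball is open, so the two errors must add up to
     strictly less than [e]. *)
  have e4 : 0 < e / 4 by rewrite divr_gt0.
  have [s fs ys] := finite_range_approx _ y _ e4.
  (* The difference [s - v] is eventually constant, hence close to some [w] in [V]; then [v + w] is
     close to [s]. *)
  have [v Vv sv] := UVC s fs.
  have [w Vw svw] := approximable_eventually_constant _ _ _ lV V0V sv _ e4.
  exists (v + w); split; last exact: submoduleD.
  apply: eO; rewrite -ball_normE /=.
  apply: (@le_lt_trans _ _ (e / 4 + e / 4)); last lra.
  apply: linfty_norm_ler => n.
  have -> : (y - (v + w)) n = (y n - s n) + ((s - v) n - w n).
    change (y n - (v n + w n) = (y n - s n) + ((s n - v n) - w n)).
    by rewrite !addrA subrK opprD addrA.
  exact: le_trans (ler_normD _ _) (lerD (ys n) (svw n)).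
- move=> x Vx; have [xc|xc] := pselect (eventually_constant _ x).
    by right; apply: VC.
  by left; have [k] := Lset_finite_range _ _ (VU _ Vx) xc; exists k.
Qed.
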